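(* Let $d\ge4$ be an integer, $m>1$, $0\le\alpha<1$, $H_0>0$, $a_0>0$, and for $\tau\ge0$ let $H(\tau)=H_0(1+\tau)^{-\alpha}$, equivalently $$a(\tau)=a_0\exp\!\Big(\frac{H_0}{1-\alpha}\big((1+\tau)^{1-\alpha}-1\big)\Big).$$ Let $\sigma:=\frac{d+2-(d-2)m}{2}$ and $g(\tau):=a(\tau)^{\sigma}$. If $\sigma<0$ (equivalently $m>m_{\mathrm{conf}}:=\frac{d+2}{d-2}$), then $g\in L^1([0,\infty))$ and $$\int_\tau^\infty a(s)^{\sigma}\,ds\;\lesssim\;(1+\tau)^{\alpha}\,a(\tau)^{\sigma},\qquad \tau\ge0 .$$
   Context: Here $a$ is the scale factor with initial value $a(0)=a_0$ and $H=\dot a/a$, where the dot denotes $\frac{d}{d\tau}$. $A\lesssim B$ means $A\le CB$ with a constant $C>0$ independent of $\tau$ (it may depend on $d,m,\alpha,H_0,a_0$). *)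

(* Defs.v *)
From HB Require Import structures.
From mathcomp Require Import all_boot all_order all_algebra.
From mathcomp Require Import all_classical all_reals all_analysis.
Set Implicit Arguments.
Unset Strict Implicit.
Unset Printing Implicit Defensive.
Import Order.TTheory GRing.Theory Num.Theory.
Import numFieldNormedType.Exports.
Local Open Scope classical_set_scope.
Local Open Scope ring_scope.

(* Derivative of a function on the half-line [0, +oo[: only the values at
   nonnegative times are used, so it is the right derivative at 0 and the usual
   derivative at t > 0. *)
Definition dot_quotient (R : realType) (a : R -> R) (t s : R) : R :=
  (a s - a t) / (s - t).

Definition dot_derivable (R : realType) (a : R -> R) (t : R) : Prop :=
  cvg (dot_quotient a t s @[s --> within `[0, +oo[ t^']).

Definition dot (R : realType) (a : R -> R) (t : R) : R :=
  lim (dot_quotient a t s @[s --> within `[0, +oo[ t^']).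

Definition hubble (R : realType) (a : R -> R) (t : R) : R := dot a t / a t.

Definition scale_factor (R : realType) (a0 : R) (a : R -> R) : Prop :=
  a 0 = a0 /\ forall t : R, 0 <= t -> 0 < a t /\ dot_derivable a t.

Definition hubble_law (R : realType) (alpha H0 : R) (a : R -> R) : Prop :=
  forall t : R, 0 <= t -> hubble a t = H0 * (1 + t) `^ (- alpha).

Definition explicit_scale_factor (R : realType) (alpha H0 a0 t : R) : R :=
  a0 * expR (H0 / (1 - alpha) * ((1 + t) `^ (1 - alpha) - 1)).

Definition sigma_exp (R : realType) (d : nat) (m : R) : R :=
  (d%:R + 2 - (d%:R - 2) * m) / 2.

Definition m_conf (R : realType) (d : nat) : R := (d%:R + 2) / (d%:R - 2).

(* Main.v *)
(* The half-line derivative is the ordinary one at positive times and forces right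
   continuity at [0], so the mean value theorem applied to [a] times the reciprocal
   exponential gives uniqueness for [a' = H a]. For the tail, write [g = a^sigma],
   so that [g' = sigma H g]. With [B] large, [F = ((1 + t)^alpha + B) g] satisfies
   [e g <= - F'] for [e = - sigma H0 / 2], so that the tail integral of [g] is at
   most [F / e], and [F <= (1 + B) (1 + t)^alpha g] since [(1 + t)^alpha >= 1]. *)
Require Import Defs.
From HB Require Import structures.
From mathcomp Require Import all_boot all_order all_algebra.
From mathcomp Require Import all_classical all_reals all_analysis.
From mathcomp Require Import measurable_realfun ring lra.
Set Implicit Arguments.
Unset Strict Implicit.
Unset Printing Implicit Defensive.
Import Order.TTheory GRing.Theory Num.Theory.
Import numFieldNormedType.Exports.
Local Open Scope classical_set_scope.
Local Open Scope ring_scope.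

(** * Derivatives on the half-line *)

Section half_line_derivative.
Variable R : realType.
Implicit Types (a f : R -> R) (t x l : R).

Lemma is_derive_continuous f t l :
  is_derive t 1 f l -> {for t, continuous f}.
Proof. by move=> [? _]; exact/differentiable_continuous/derivable1_diffP. Qed.

(** The change of variable [s = h + t] carries punctured neighbourhoods of 0 to those of [t] and
    back. *)
Lemma is_derive_dot_quotient f t l :
  is_derive t 1 f l <-> dot_quotient f t s @[s --> t^'] --> l.
Proof.
have q_shift h : h^-1 *: ((f \o shift t) (h *: 1) - f t) =
    dot_quotient f t (h + t).
  by rewrite /dot_quotient /= addrK scaler1 [LHS]mulrC.
have from0 : (h + t) @[h --> 0^'] --> t^'.
  move=> A [e /= e0 eA]; exists e => //= h /= he h0.
  apply: eA; first by rewrite /= opprD addrCA subrr addr0 -[X in `|X|]sub0r.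
  by rewrite -subr_eq0 addrK.
have to0 : (s - t) @[s --> t^'] --> 0^'.
  move=> A [e /= e0 eA]; exists e => //= s /= se st.
  by apply: eA; rewrite /= ?subr_eq0// sub0r opprB.
split=> [[df <-]|ql].
- have H : dot_quotient f t (h + t) @[h --> 0^'] --> 'D_1 f t.
    by under eq_fun do rewrite -q_shift; exact: df.
  have : dot_quotient f t (s - t + t) @[s --> t^'] --> 'D_1 f t.
    exact: (cvg_comp _ _ to0 H).
  by under eq_fun do rewrite subrK.
- have H : h^-1 *: ((f \o shift t) (h *: 1) - f t) @[h --> 0^'] --> l.
    by under eq_fun do rewrite q_shift; exact: (cvg_comp _ _ from0 ql).
  by apply: DeriveDef; [apply/cvg_ex; exists l|exact: (cvg_lim _ H)].
Qed.

Lemma at_right_within_dnbhs t : 0 <= t -> t^'+ `=>` within `[0, +oo[ t^'.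
Proof.
move=> t0 A [e /= e0 eA]; exists e => //= s /= se ts.
by apply: eA => //; rewrite ?gt_eqF//= in_itv/= andbT (le_trans t0)// ltW.
Qed.

(** Properness makes the [lim] in [dot] the unique limit; right neighbourhoods of [t] provide it,
    even at [t = 0]. *)
Lemma half_line_dnbhs_proper t : 0 <= t -> ProperFilter (within `[0, +oo[ t^').
Proof.
move=> t0; apply: Build_ProperFilter_ex => A /at_right_within_dnbhs -/(_ t0).
exact: filter_ex.
Qed.

Lemma dotP a t l : 0 <= t ->
  dot_derivable a t /\ dot a t = l <->
  dot_quotient a t s @[s --> within `[0, +oo[ t^'] --> l.
Proof.
move=> t0; split=> [[da <-]//|al].
have ? := half_line_dnbhs_proper t0.
by split; [apply/cvg_ex; exists l|exact: (cvg_lim _ al)].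
Qed.

(** Near [t > 0] the restriction to the half-line is vacuous, since a small ball contains only
    nonnegative times. *)
Lemma is_derive_dot a t : 0 < t -> dot_derivable a t ->
  is_derive t 1 a (dot a t).
Proof.
move=> t0 da; apply/is_derive_dot_quotient.
apply: cvg_trans da; apply: cvg_app.
move=> A [e /= e0 eA].
near=> s.
apply: eA => /=.
- by near: s; apply: nbhs_dnbhs; exact: nbhsx_ballx.
- by near: s; exact: nbhs_dnbhs_neq.
- rewrite in_itv/= andbT; near: s; apply: nbhs_dnbhs.
  exact: lt_le_nbhsr.
Unshelve. all: by end_near. Qed.

(** Negative times never enter the quotient of [a], so a two-sided derivative of [f] computes
    [dot a], including at 0. *)
Lemma is_derive_eq_dot a f t l : 0 <= t ->
  (forall s, 0 <= s -> a s = f s) -> is_derive t 1 f l ->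
  dot_derivable a t /\ dot a t = l.
Proof.
move=> t0 af /is_derive_dot_quotient fl; apply/dotP => //.
apply: (@cvg_trans _ (dot_quotient f t s @[s --> within `[0, +oo[ t^'])).
  apply: near_eq_cvg; rewrite near_withinE; near=> s.
  by rewrite /= in_itv/= andbT => s0; rewrite /dot_quotient !af.
by apply: cvg_trans fl; apply: cvg_app; exact: cvg_within.
Unshelve. all: by end_near. Qed.

Lemma dot_derivable_cvg_at_right a t : 0 <= t -> dot_derivable a t ->
  a s @[s --> t^'+] --> a t.
Proof.
move=> t0 da.
have q : dot_quotient a t s @[s --> t^'+] --> dot a t.
  by apply: cvg_trans da; apply: cvg_app; exact: at_right_within_dnbhs.
have st : (s - t) @[s --> t^'+] --> (0 : R).
  apply: cvg_at_right_filter; rewrite -(subrr t).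
  by apply: cvgB; [exact: cvg_id|exact: cvg_cst].
(* For [s] different from [t] this expression is [a s], and the factor [s - t] kills the convergent
   quotient. *)
have : dot_quotient a t s * (s - t) + a t @[s --> t^'+] -->
    dot a t * 0 + a t.
  by apply: cvgD; [exact: cvgM|exact: cvg_cst].
rewrite mulr0 add0r => qa; apply: cvg_trans qa; apply: near_eq_cvg; near=> s.
rewrite /= /dot_quotient divfK ?subrK// subr_eq0 gt_eqF//.
Unshelve. all: by end_near. Qed.

End half_line_derivative.

(** * Tail integrals through a decreasing primitive *)

Section tail_integral.
Variable R : realType.
Implicit Types (f F : R -> R) (x t : R).

Lemma continuous_for_within_itvcy f t :
  (forall x, t <= x -> {for x, continuous f}) ->
  {within `[t, +oo[, continuous f}.
Proof.
move=> cf; apply: continuous_in_subspaceT => x.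
by rewrite inE/= in_itv/= andbT; exact: cf.
Qed.

Lemma continuous_measurable_itvcy f t :
  (forall x, t <= x -> {for x, continuous f}) -> measurable_fun `[t, +oo[ f.
Proof.
move=> cf; apply: subspace_continuous_measurable_fun => //.
exact: continuous_for_within_itvcy.
Qed.

Lemma nonincreasing_ge0_is_cvgy F t :
  (forall x y, t <= x -> x <= y -> F y <= F x) ->
  (forall x, t <= x -> 0 <= F x) ->
  exists2 l : R, 0 <= l & F x @[x --> +oo] --> l.
Proof.
(* [F] is monotone only from [t] on; freezing it at [F t] further left makes [G] monotone on the
   whole line. *)
move=> Fd F0; pose G x := - F (Num.max t x).
have ubG : ubound (range G) 0.
  by move=> _ [x _ <-]; rewrite oppr_le0 F0// le_max lexx.
have ndG : nondecreasing_fun G.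
  move=> x y xy; rewrite lerN2; apply: Fd; first by rewrite le_max lexx.
  by rewrite ge_max !le_max lexx xy orbT.
exists (- sup (range G)).
  by rewrite oppr_ge0; apply: ge_sup => //; exists (G 0), 0.
have /cvgN Gl := nondecreasing_cvgr ndG (ex_intro _ _ ubG).
apply: cvg_trans Gl; apply: near_eq_cvg; near=> x.
rewrite /= /G opprK max_r//; near: x; exact: nbhs_pinfty_ge.
Unshelve. all: by end_near. Qed.

(** The integral is [F t - l], where [l >= 0] is the limit at infinity of the nonincreasing [F]. *)
Lemma ge0_integral_tail_le f F t :
  (forall x, t <= x -> 0 <= f x) ->
  (forall x, t <= x -> {for x, continuous f}) ->
  (forall x, t <= x -> is_derive x 1 F (- f x)) ->
  (forall x, t <= x -> 0 <= F x) ->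
  (\int[@lebesgue_measure R]_(x in `[t, +oo[) (f x)%:E <= (F t)%:E)%E.
Proof.
move=> f0 cf dF F0.
have cF x : t <= x -> {for x, continuous F}.
  by move=> /dF/is_derive_continuous.
have F'E x : t <= x -> (F^`())%classic x = - f x.
  by move=> tx; rewrite derive1E; have [_] := dF x tx.
have [x y tx xy|x tx|l l0 Fl] := @nonincreasing_ge0_is_cvgy F t.
- apply: (@ler0_derive1_nincry _ F t) => //.
  + by move=> z; rewrite in_itv/= andbT => /ltW tz; have [] := dF z tz.
  + by move=> z; rewrite in_itv/= andbT => /ltW tz; rewrite F'E// oppr_le0 f0.
  + exact: continuous_for_within_itvcy.
- exact: F0.
rewrite (@ge0_continuous_FTC2y _ f (\- F) t (- l)) => //.
- by rewrite EFinN -EFinB lee_fin/= opprK; lra.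
- exact: continuous_for_within_itvcy.
- exact: cvgN.
- by move=> x /ltW tx; apply: derivableN; have [] := dF x tx.
- by apply: cvgN; apply: cvg_at_right_filter; exact: cF.
- move=> x; rewrite in_itv/= andbT => /ltW tx.
  have [? _] := dF x tx.
  by rewrite derive1E deriveN// -derive1E F'E// opprK.
Qed.

End tail_integral.

(** * The explicit scale factor: uniqueness and decay of its powers *)

Section exponential_scale_factor.
Variables (R : realType) (alpha H0 a0 : R).
Hypotheses (alpha_ge0 : 0 <= alpha) (alpha_lt1 : alpha < 1).
Hypotheses (H0_gt0 : 0 < H0) (a0_gt0 : 0 < a0).

Let H (t : R) := H0 * (1 + t) `^ (- alpha).
Let phi (t : R) := H0 / (1 - alpha) * ((1 + t) `^ (1 - alpha) - 1).
Let E := explicit_scale_factor alpha H0 a0.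

Lemma is_derive_powR1D (p t : R) : 0 <= t ->
  is_derive t 1 (fun s => (1 + s) `^ p) (p * (1 + t) `^ (p - 1)).
Proof.
move=> t0.
have dp : is_derive (1 + t) 1 (@powR R ^~ p) (p * (1 + t) `^ (p - 1)).
  by apply: is_derive1_powR; lra.
have ds : is_derive t 1 (fun s : R => 1 + s) 1.
  by under eq_fun do rewrite addrC; exact: is_derive_shift.
by have := is_derive1_comp dp ds; rewrite mulr1.
Qed.

Let is_derive_phi (t : R) : 0 <= t -> is_derive t 1 phi (H t).
Proof.
move=> t0; have dp := is_derive_powR1D (1 - alpha) t0.
have dp1 := is_deriveB dp (is_derive_cst (1 : R) t 1).
apply: (is_derive_eq (is_deriveZ (H0 / (1 - alpha)) dp1)).
rewrite /H subr0 /GRing.scale /= addrAC subrr add0r.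
by field; rewrite subr_eq0 gt_eqF.
Qed.

(** Taken with [c = 1] for [E] and with [c = -1] for the reciprocal exponential in the uniqueness
    argument. *)
Let is_derive_expphi (c t : R) : 0 <= t ->
  is_derive t 1 (fun s => expR (c * phi s)) (c * H t * expR (c * phi t)).
Proof.
move=> t0; have dc : is_derive t 1 (fun s => c * phi s) (c * H t).
  exact: is_deriveZ (is_derive_phi t0).
have := @is_derive1_comp R expR (fun s => c * phi s) t _ _
  (is_derive_expR (c * phi t)) dc.
by rewrite mulrC.
Qed.

Lemma explicit_scale_factor_gt0 t : 0 < E t.
Proof. by rewrite mulr_gt0// expR_gt0. Qed.

Lemma explicit_scale_factor_0 : E 0 = a0.
Proof.
by rewrite /E /explicit_scale_factor addr0 powR1 subrr mulr0 expR0 mulr1.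
Qed.

Lemma is_derive_explicit_scale_factor (t : R) : 0 <= t ->
  is_derive t 1 E (H t * E t).
Proof.
move=> t0; have := is_deriveZ a0 (is_derive_expphi 1 t0).
rewrite !mul1r -[X in is_derive _ _ X](_ : E = _); last first.
  by apply/funext => s; rewrite /= mul1r.
by rewrite /GRing.scale /= mulrCA.
Qed.

Lemma explicit_scale_factor_solution a :
  (forall t, 0 <= t -> a t = E t) ->
  scale_factor a0 a /\ hubble_law alpha H0 a.
Proof.
move=> aE; have dotE t : 0 <= t -> dot_derivable a t /\ dot a t = H t * E t.
  move=> t0.
  exact: is_derive_eq_dot t0 aE (is_derive_explicit_scale_factor t0).
split; first split.
- by rewrite aE// explicit_scale_factor_0.
- move=> t t0; rewrite aE//; split; first exact: explicit_scale_factor_gt0.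
  by have [] := dotE t t0.
- move=> t t0; rewrite /hubble; have [_ ->] := dotE t t0.
  by rewrite aE// mulfK// gt_eqF// explicit_scale_factor_gt0.
Qed.

Lemma hubble_law_explicit a : scale_factor a0 a -> hubble_law alpha H0 a ->
  forall t, 0 <= t -> a t = E t.
Proof.
move=> [a00 apos] aH.
have dota t : 0 <= t -> dot a t = H t * a t.
  move=> t0; rewrite /H -aH// /hubble divfK// gt_eqF//.
  by have [] := apos t t0.
(* b = a / (E / a0) has zero derivative on ]0, +oo[. *)
pose b t := a t * expR (- 1 * phi t).
have db (t : R) : 0 < t -> is_derive t 1 b 0.
  move=> t0; have [_ da] := apos t (ltW t0).
  have da' := is_derive_dot t0 da.
  have de := is_derive_expphi (- 1) (ltW t0).
  apply: (is_derive_eq (is_deriveM da' de)); rewrite dota ?ltW// /GRing.scale /=; ring.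
have b0 : b 0 = a0.
  by rewrite /b /phi addr0 powR1 subrr !mulr0 expR0 mulr1.
move=> t; rewrite le_eqVlt => /predU1P[<-|t0].
  by rewrite explicit_scale_factor_0.
have bt : b t = a0.
  have bcont (x : R) : 0 < x -> {for x, continuous b}.
    by move=> /db/is_derive_continuous.
  have [x||c _] := @MVT _ b (cst 0) 0 t t0.
  - by rewrite in_itv/= => /andP[x0 _]; exact: db.
  - apply/continuous_within_itvP => //; split.
    + by move=> x; rewrite in_itv/= => /andP[x0 _]; exact: bcont.
    (* At 0 the one-sided derivative of [a] supplies the right continuity required by the mean value
       theorem. *)
    + apply: cvgM; first by apply: dot_derivable_cvg_at_right => //; apply apos.
      apply: cvg_at_right_filter.
      exact: is_derive_continuous (is_derive_expphi (- 1) (lexx 0)).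
    + exact/cvg_at_left_filter/bcont.
  - by rewrite mul0r b0 => /eqP; rewrite subr_eq0 => /eqP.
rewrite /E /explicit_scale_factor -/(phi t) -bt /b mulN1r expRN mulfVK//.
by rewrite gt_eqF// expR_gt0.
Qed.

(* [B] absorbs the bounded range of [u] where [alpha * u `^ (alpha - 1)] is not yet
   below [e]: there [u `^ alpha] is at most [e `^ (- alpha / (1 - alpha))]. *)
Lemma powR_absorb (e : R) : 0 < e -> exists2 B : R, 0 <= B &
  forall u, 1 <= u -> alpha * u `^ (alpha - 1) <= e + B * u `^ (- alpha).
Proof.
move=> e0; have a1 : 0 < 1 - alpha by rewrite subr_gt0.
pose V := (e^-1) `^ ((1 - alpha)^-1 * alpha).
exists V; first exact: powR_ge0.
move=> u u1; have u0 : 0 < u by lra.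
have wE : u `^ (alpha - 1) = (u `^ (1 - alpha))^-1 by rewrite -powRN opprB.
have w1 : 1 <= u `^ (1 - alpha).
  by rewrite -[leLHS](powRr0 u) ler_powR// ltW.
have w0 : 0 < u `^ (alpha - 1) by exact: powR_gt0.
have wle1 : u `^ (alpha - 1) <= 1 by rewrite wE invf_le1// (lt_le_trans ltr01).
have v0 : 0 < u `^ (- alpha) by exact: powR_gt0.
have V0 : 0 <= V by exact: powR_ge0.
have [we|ew] := leP (u `^ (alpha - 1)) e; first by nra.
have VB : u `^ alpha <= V.
  have -> : u `^ alpha = (u `^ (1 - alpha)) `^ ((1 - alpha)^-1 * alpha).
    by rewrite -powRrM mulrA divff ?mul1r// gt_eqF.
  rewrite ge0_ler_powR// ?nnegrE ?invr_ge0 ?powR_ge0 ?(ltW e0)//.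
    by rewrite mulr_ge0// invr_ge0 ltW.
  by rewrite -[leLHS]invrK -wE lef_pV2// ?posrE// ltW.
(* In this case the second term alone suffices, since alpha u^(alpha-1) <= 1. *)
have : 1 <= V * u `^ (- alpha).
  by rewrite powRN ler_pdivlMr ?mul1r// powR_gt0.
nra.
Qed.

Lemma continuous_powR1D (p t : R) : 0 <= t ->
  {for t, continuous (fun s : R => (1 + s) `^ p)}.
Proof.
by move=> t0; exact: is_derive_continuous (is_derive_powR1D p t0).
Qed.

Lemma is_derive_explicit_scale_factor_powR (sigma t : R) : 0 <= t ->
  is_derive t 1 (fun s => E s `^ sigma) (sigma * H t * E t `^ sigma).
Proof.
move=> t0; have E0 := explicit_scale_factor_gt0 t.
have dE := is_derive_explicit_scale_factor t0.
have := @is_derive1_comp R (@powR R ^~ sigma) E t _ _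
  (is_derive1_powR sigma E0) dE.
rewrite powRB; last by rewrite (gt_eqF E0) implybT.
rewrite powRr1 ?ltW// (_ : _ * _ = sigma * H t * E t `^ sigma)//.
by field; rewrite gt_eqF.
Qed.

Lemma continuous_explicit_scale_factor_powR (sigma t : R) : 0 <= t ->
  {for t, continuous (fun s : R => E s `^ sigma)}.
Proof.
move=> t0.
exact: is_derive_continuous (is_derive_explicit_scale_factor_powR sigma t0).
Qed.

Lemma measurable_explicit_scale_factor_powR (sigma t : R) : 0 <= t ->
  measurable_fun `[t, +oo[ (fun s => E s `^ sigma).
Proof.
move=> t0; apply: continuous_measurable_itvcy => s ts.
by apply: continuous_explicit_scale_factor_powR; rewrite (le_trans t0).
Qed.

(* The term [B g] in [F] compensates the small times at which [(1 + t)^alpha g]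
   alone may be increasing. *)
Lemma explicit_scale_factor_tail (sigma : R) : sigma < 0 ->
  exists2 C : R, 0 < C & forall t, 0 <= t ->
    (\int[@lebesgue_measure R]_(s in `[t, +oo[) (E s `^ sigma)%:E
      <= (C * ((1 + t) `^ alpha * E t `^ sigma))%:E)%E.
Proof.
(* With this [e], (1+t)^alpha g' = -2 e g: one half absorbs the derivative of (1+t)^alpha, the other
   half remains. *)
move=> sigma0; pose e := - sigma * H0 / 2.
have e0 : 0 < e by rewrite divr_gt0// mulr_gt0// oppr_gt0.
(* Dividing by [2 * e] makes (B g)' equal to -B0 (1+t)^(-alpha) g, the correction offered by
   [powR_absorb]. *)
have [B0 B0_ge0 hB] := powR_absorb e0; pose B := B0 / (2 * e).
have B_ge0 : 0 <= B by rewrite /B divr_ge0//; lra.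
have BE : 2 * e * B = B0 by rewrite /B; field; rewrite gt_eqF.
exists ((1 + B) / e); first by rewrite divr_gt0//; lra.
move=> t t0; pose g s := E s `^ sigma.
have g0 s : 0 <= g s by exact: powR_ge0.
(* This is [- F']; [powR_absorb] at [u = 1 + s] keeps the bracket at least [e]. *)
pose f s := g s * (2 * e + B0 * (1 + s) `^ (- alpha)
                   - alpha * (1 + s) `^ (alpha - 1)).
pose F s := ((1 + s) `^ alpha + B) * g s.
have gf s : t <= s -> e * g s <= f s.
  move=> ts; rewrite /f [leRHS]mulrC ler_wpM2r//.
  by have := hB (1 + s); rewrite lerDl (le_trans t0 ts) => /(_ isT); lra.
have f0 s : t <= s -> 0 <= f s.
  by move=> ts; rewrite (le_trans _ (gf s ts))// mulr_ge0// ltW.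
have cf (s : R) : t <= s -> {for s, continuous f}.
  move=> ts; have s0 := le_trans t0 ts.
  apply: cvgM; first exact: continuous_explicit_scale_factor_powR.
  apply: cvgB; first apply: cvgD; first exact: cvg_cst.
  - by apply: cvgM; [exact: cvg_cst|exact: continuous_powR1D].
  - by apply: cvgM; [exact: cvg_cst|exact: continuous_powR1D].
have dF (s : R) : t <= s -> is_derive s 1 F (- f s).
  move=> ts; have s0 := le_trans t0 ts.
  have dg := is_derive_explicit_scale_factor_powR sigma s0.
  have dp := is_derive_powR1D alpha s0.
  have dpB := is_deriveD dp (is_derive_cst B s 1).
  apply: (is_derive_eq (is_deriveM dpB dg)); rewrite addr0 /GRing.scale /= -/(g s) /f /H -BE.
  have pN : (1 + s) `^ alpha * (1 + s) `^ (- alpha) = 1.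
    by rewrite powRN mulfV// gt_eqF// powR_gt0//; lra.
  (* Substituting sigma H0 = -2 e exposes the product of opposite powers, which [pN] collapses to
     1. *)
  have -> : ((1 + s) `^ alpha + B) * (sigma * (H0 * (1 + s) `^ (- alpha)) * g s)
    = - (2 * e) * ((1 + s) `^ alpha * (1 + s) `^ (- alpha)
                   + B * (1 + s) `^ (- alpha)) * g s by rewrite /e; field.
  by rewrite pN; ring.
have F0 s : t <= s -> 0 <= F s.
  by move=> ts; rewrite mulr_ge0// addr_ge0// powR_ge0.
have mg : measurable_fun `[t, +oo[ g.
  exact: measurable_explicit_scale_factor_powR.
have mf : measurable_fun `[t, +oo[ f by exact: continuous_measurable_itvcy.
have ge_int : (e%:E * \int[@lebesgue_measure R]_(s in `[t, +oo[) (g s)%:E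
               <= (F t)%:E)%E.
  apply: le_trans (ge0_integral_tail_le f0 cf dF F0).
  rewrite -ge0_integralZl//; last 3 first.
  - exact/measurable_EFinP.
  - by move=> s _; rewrite lee_fin.
  - by rewrite lee_fin ltW.
  apply: ge0_le_integral => //.
  - by move=> s _; rewrite lee_fin mulr_ge0// ltW.
  - by apply/measurable_EFinP; apply: measurable_funM => //.
  - by apply/measurable_EFinP.
  - by move=> s; rewrite /= in_itv/= andbT => ts; rewrite lee_fin gf.
have : (\int[@lebesgue_measure R]_(s in `[t, +oo[) (g s)%:E
        <= (e^-1 * F t)%:E)%E.
  by rewrite EFinM lee_pdivlMl.
move/le_trans; apply; rewrite lee_fin /F -/(g t).
(* This lets the constant [B] in [F t] be absorbed as B (1+t)^alpha, whence the factor [1 + B]. *)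
have : 1 <= (1 + t) `^ alpha.
  by rewrite -[leLHS](powRr0 (1 + t)) ler_powR//; lra.
move=> v1.
have -> : (1 + B) / e * ((1 + t) `^ alpha * g t) =
    e^-1 * ((1 + B) * (1 + t) `^ alpha * g t) by ring.
by rewrite ler_wpM2l ?invr_ge0 ?(ltW e0)// ler_wpM2r//; nra.
Qed.

End exponential_scale_factor.

(** * The conformal threshold and the final assembly *)

Lemma sigma_exp_lt0 (R : realType) (d : nat) (m : R) : (2 < d)%N ->
  sigma_exp d m < 0 <-> m_conf R d < m.
Proof.
rewrite -(ltr_nat R) => d2.
rewrite /sigma_exp /m_conf ltr_pdivrMr// mul0r ltr_pdivrMr ?subr_gt0//.
by split; lra.
Qed.

Theorem lemma3p1 (R : realType) (d : nat) (m alpha H0 a0 : R)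
  (hd : (4 <= d)%N) (hm : 1 < m) (halpha0 : 0 <= alpha) (halpha1 : alpha < 1)
  (hH0 : 0 < H0) (ha0 : 0 < a0) :
  [/\ forall a : R -> R,
        scale_factor a0 a /\ hubble_law alpha H0 a <->
        (forall t : R, 0 <= t -> a t = explicit_scale_factor alpha H0 a0 t),
      sigma_exp d m < 0 <-> m_conf R d < m
    & sigma_exp d m < 0 ->
      exists2 C : R, 0 < C &
        forall a : R -> R, scale_factor a0 a -> hubble_law alpha H0 a ->
          (@lebesgue_measure R).-integrable `[0, +oo[
            (fun s : R => (a s `^ sigma_exp d m)%:E) /\
          forall tau : R, 0 <= tau ->
            (\int[@lebesgue_measure R]_(s in `[tau, +oo[)
               (a s `^ sigma_exp d m)%:E
             <= (C * ((1 + tau) `^ alpha * a tau `^ sigma_exp d m))%:E)%E].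
Proof.
split.
- move=> a; split=> [[sa ha]|]; first exact: hubble_law_explicit.
  exact: explicit_scale_factor_solution.
- by apply: sigma_exp_lt0; exact: leq_trans hd.
move=> sigma0.
have [C C0 tail] := explicit_scale_factor_tail halpha0 halpha1 hH0 ha0 sigma0.
(* [C] is chosen before [a], so it depends on the parameters only. *)
exists C => // a sa ha.
have aE := hubble_law_explicit halpha1 sa ha.
(* [a] and the explicit formula agree only at nonnegative times, so the integrands are compared on
   the domain of integration. *)
have tail_a t : 0 <= t ->
    (\int[@lebesgue_measure R]_(s in `[t, +oo[) (a s `^ sigma_exp d m)%:E
      <= (C * ((1 + t) `^ alpha * a t `^ sigma_exp d m))%:E)%E.
  move=> t0; rewrite aE//; apply: le_trans (tail t t0).
  rewrite le_eqVlt; apply/orP; left; apply/eqP; apply: eq_integral => s.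
  by rewrite inE/= in_itv/= andbT => ts; rewrite aE// (le_trans t0).
split=> //; apply/integrableP; split.
  apply/measurable_EFinP.
  apply: (eq_measurable_fun
    (fun s => explicit_scale_factor alpha H0 a0 s `^ sigma_exp d m)).
    by move=> s; rewrite inE/= in_itv/= andbT => s0; rewrite aE.
  exact: measurable_explicit_scale_factor_powR.
(* The integrand is nonnegative, so the tail bound at time 0 already gives a finite norm. *)
under eq_integral do rewrite gee0_abs ?lee_fin ?powR_ge0//.
by apply: le_lt_trans (tail_a 0 _) _; rewrite // ltry.
Qed.
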